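(* There is no (nonempty) simplicial complex $X$ whose link at every vertex is simplicially isomorphic to the graph $G_5$.
   Context: $G_5$ (the ''inverse pyramid'') is the following graph with 14 vertices and 18 edges: take a hexagon with cyclically ordered vertices $h_1,\dots,h_6$ (6 edges $h_ih_{i+1}$, indices mod 6), two further vertices $b$ and $t$, join $b$ to each of $h_1,h_3,h_5$ by a path with two edges, and join $t$ to each of $h_2,h_4,h_6$ by a path with two edges (each of these six paths has one new interior vertex of valency 2). It is one of the graphs obtained from the incidence graph of the Fano plane by deleting three pairwise disjoint open edges. *)

(* Defs.v *)
From HB Require Import structures.
From mathcomp Require Import all_boot finmap.
From mathcomp Require Import boolp classical_sets.

Set Implicit Arguments.
Unset Strict Implicit.
Unset Printing Implicit Defensive.

Local Open Scope fset_scope.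
Local Open Scope classical_set_scope.

(* Simplices are nonempty finite sets.  Points of [V] need not be vertices,
   and [V] may be infinite. *)
Record simplicial_complex (V : choiceType) := SimplicialComplex {
  faces : set {fset V};
  face_neq0 : forall s, faces s -> s != fset0;
  face_sub : forall s t, faces s -> t != fset0 -> (t `<=` s)%fset -> faces t }.

Definition vertices (V : choiceType) (X : simplicial_complex V) : set V :=
  [set v | faces X [fset v]].

Section Link.
Variables (V : choiceType) (X : simplicial_complex V) (v : V).

Definition link_faces : set {fset V} :=
  [set s | [/\ s != fset0, v \notin s & faces X (v |` s)%fset]].

Lemma link_face_neq0 s : link_faces s -> s != fset0.
Proof. by case. Qed.

Lemma link_face_sub s t :
  link_faces s -> t != fset0 -> (t `<=` s)%fset -> link_faces t.
Proof.
move=> [_ vs Xs] t0 ts; split=> //.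
  by apply: contra vs; apply: (fsubsetP ts).
by apply: face_sub Xs _ (fsetUS _ ts); apply/fset0Pn; exists v; rewrite fset1U1.
Qed.

Definition link : simplicial_complex V :=
  SimplicialComplex link_face_neq0 link_face_sub.

End Link.

Definition simplicially_isomorphic (V W : choiceType)
    (X : simplicial_complex V) (Y : simplicial_complex W) : Prop :=
  exists f : vertices X -> vertices Y, bijective f /\
    forall s : {fset vertices X},
      faces X [fset val x | x in s] <-> faces Y [fset val (f x) | x in s].

Section GraphComplex.
Variables (V : choiceType) (e : rel V).

Definition graph_faces : set {fset V} :=
  [set s | (exists x, s = [fset x]) \/ (exists x y, e x y /\ s = [fset x; y])].

Lemma graph_face_neq0 s : graph_faces s -> s != fset0.
Proof.
by case=> [[x ->]|[x [y [_ ->]]]]; apply/fset0Pn; exists x; rewrite !inE eqxx.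
Qed.

Lemma graph_face_sub s t :
  graph_faces s -> t != fset0 -> (t `<=` s)%fset -> graph_faces t.
Proof.
have sub1 x : t != fset0 -> (t `<=` [fset x])%fset -> graph_faces t.
  by move=> t0; rewrite fsubset1 (negPf t0) orbF => /eqP ->; left; exists x.
case=> [[x ->]|[x [y [exy ->]]]] t0; first exact: sub1.
move=> ts; have [xt|xt] := boolP (x \in t); last first.
  apply: (sub1 y t0); apply/fsubsetP => z zt; have := fsubsetP ts z zt.
  by rewrite !inE => /orP[/eqP zx|//]; rewrite -zx zt in xt.
have [yt|yt] := boolP (y \in t); last first.
  apply: (sub1 x t0); apply/fsubsetP => z zt; have := fsubsetP ts z zt.
  by rewrite !inE => /orP[//|/eqP zy]; rewrite -zy zt in yt.
right; exists x, y; split=> //; apply/eqP; rewrite eqEfsubset ts /=.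
by apply/fsubsetP => z; rewrite !inE => /orP[] /eqP ->.
Qed.

Definition graph_complex : simplicial_complex V :=
  SimplicialComplex graph_face_neq0 graph_face_sub.

End GraphComplex.

(* [Hex i] is h_(i+1), and [Mid i] is the interior vertex of the two-edge path
   from [Hex i] to [Bot] = b (i = 0, 2, 4) or [Top] = t (i = 1, 3, 5). *)
Inductive G5_vertex := Hex of 'I_6 | Mid of 'I_6 | Bot | Top.

Definition G5_encode (u : G5_vertex) : 'I_6 + 'I_6 + bool :=
  match u with
  | Hex i => inl (inl i)
  | Mid i => inl (inr i)
  | Bot => inr false
  | Top => inr true
  end.

Definition G5_decode (c : 'I_6 + 'I_6 + bool) : G5_vertex :=
  match c with
  | inl (inl i) => Hex i
  | inl (inr i) => Mid i
  | inr false => Bot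
  | inr true => Top
  end.

Lemma G5_encodeK : cancel G5_encode G5_decode.
Proof. by case. Qed.

HB.instance Definition _ := Finite.copy G5_vertex (can_type G5_encodeK).

Definition G5_arc (u v : G5_vertex) : bool :=
  match u, v with
  | Hex i, Hex j => j == ordS i
  | Hex i, Mid j => j == i
  | Mid i, Bot => ~~ odd i
  | Mid i, Top => odd i
  | _, _ => false
  end.

Definition G5_edge : rel G5_vertex := [rel u v | G5_arc u v || G5_arc v u].

Definition G5 : simplicial_complex G5_vertex := graph_complex G5_edge.

(* Main.v *)
Require Import Defs.
From mathcomp Require Import all_boot finmap.
From mathcomp Require Import boolp classical_sets.

(** The degree of an edge [xy] of [X], i.e. the number of triangles containing
    it, is the valency of [y] in the link of [x] and that of [x] in the link of
    [y].  Two adjacent vertices of G5 never both have valency 2, so no triangle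
    has two edges of degree 2.  Now let [x] be the vertex t in the link of [v].
    All triangles [vxy] have [vy] of degree 2.  But the valency of [v] in the
    link of [x] is 3, and every vertex of valency 3 of G5 has a neighbour of
    valency 2, so some triangle [vxy] also has [xy] of degree 2. *)

Set Implicit Arguments.
Unset Strict Implicit.
Unset Printing Implicit Defensive.

Local Open Scope classical_set_scope.

Definition is_mid (p : G5_vertex) : bool := if p is Mid _ then true else false.

Lemma Mid_edge (i : 'I_6) (q : G5_vertex) :
  G5_edge (Mid i) q -> q = Hex i \/ q = (if odd i then Top else Bot).
Proof.
rewrite /G5_edge /=; case: q => [j|j||] //=; last 2 first.
- by rewrite orbF => /negPf ->; right.
- by rewrite orbF => ->; right.
by move=> /eqP ->; left.
Qed.

Lemma Mid_edge_not_mid (i : 'I_6) (q : G5_vertex) :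
  G5_edge (Mid i) q -> ~~ is_mid q.
Proof. by move=> /Mid_edge [->|->] //; case: ifP. Qed.

Lemma Top_edge_mid (q : G5_vertex) : G5_edge Top q -> is_mid q.
Proof. by case: q. Qed.

(** Three distinct neighbours rule out valency 2; that one of them is a [Mid] yields the second edge
    of degree 2 in the final argument. *)
Lemma edges_of_not_mid (p : G5_vertex) : ~~ is_mid p ->
  exists q1 q2 i, [/\ G5_edge p q1, G5_edge p q2, G5_edge p (Mid i)
    & uniq [:: q1; q2; Mid i]].
Proof.
case: p => [i|//||] _.
- exists (Hex (ordS i)), (Hex (ord_pred i)), i.
  rewrite /G5_edge /= ord_predK !eqxx orbT; split=> //.
  (* The two hexagon neighbours of [Hex i] differ since 2 is nonzero mod 6; this is checked on the
     six indices. *)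
  by case: i => [[|[|[|[|[|[]]]]]]].
- exists (Mid (@Ordinal 6 0 isT)), (Mid (@Ordinal 6 2 isT)), (@Ordinal 6 4 isT).
  by [].
- exists (Mid (@Ordinal 6 1 isT)), (Mid (@Ordinal 6 3 isT)), (@Ordinal 6 5 isT).
  by [].
Qed.

Section Triangles.
Variables (V : choiceType) (X : simplicial_complex V).

Definition triangle (x y z : V) : Prop :=
  [/\ x != y, x != z, y != z & faces X [fset x; y; z]%fset].

Lemma triangle_swap12 x y z : triangle x y z -> triangle y x z.
Proof.
by case=> xy xz yz Xxyz; split=> //; [rewrite eq_sym | rewrite [[fset y; x]%fset]fsetUC].
Qed.

Lemma triangle_swap23 x y z : triangle x y z -> triangle x z y.
Proof. by case=> xy xz yz Xxyz; split=> //; rewrite 1?eq_sym // fsetUAC. Qed.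

Lemma triangle_vertex x y z : triangle x y z -> vertices X x.
Proof.
case=> _ _ _ Xxyz; apply: (face_sub Xxyz); last first.
  by apply/fsubsetP => u; rewrite !inE => ->.
by apply/fset0Pn; exists x; rewrite inE.
Qed.

(** A bound by two witnesses, possibly equal, needs no finiteness of the set of triangles on the
    edge. *)
Definition degree_le2 (x y : V) : Prop :=
  exists a b, forall z, triangle x y z -> z = a \/ z = b.

Lemma degree_le2C x y : degree_le2 x y -> degree_le2 y x.
Proof. by case=> a [b ab]; exists a, b => z /triangle_swap12 /ab. Qed.

(** A labelling of the link of [v] by G5, expressed through triangles of [X] so that links at
    different vertices can be compared. As G5 has no isolated vertex, the last clause reaches every
    vertex of the link. *)
Definition link_param (v : V) (g : G5_vertex -> V) : Prop :=
  [/\ injective g,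
      forall p q, triangle v (g p) (g q) <-> G5_edge p q
    & forall x y, triangle v x y -> exists p, x = g p].

Lemma G5_edge_neq p q : G5_edge p q -> p != q.
Proof.
apply: contraTneq => ->; case: q => [i|i||] //; rewrite /G5_edge /= orbb.
by case: i => [[|[|[|[|[|[]]]]]]].
Qed.

Lemma imfset_pair (S T : choiceType) (k : S -> T) (a b : S) :
  [fset k x | x in [fset a; b]]%fset = [fset k a; k b]%fset.
Proof.
apply/fsetP => u; rewrite !inE; apply/imfsetP/orP => /=.
  by case=> w; rewrite !inE => /orP[] /eqP -> ->; [left | right].
by case=> /eqP ->; [exists a | exists b]; rewrite // !inE eqxx ?orbT.
Qed.

Lemma link_vertexP (v x : V) :
  vertices (link X v) x <-> v != x /\ faces X [fset v; x]%fset.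
Proof.
rewrite /vertices /= /link_faces /= inE; split=> [[]//|[vx Xvx]]; split=> //.
by apply/fset0Pn; exists x; rewrite inE.
Qed.

Lemma link_pairP (v x y : V) : v != x -> v != y -> x != y ->
  faces (link X v) [fset x; y]%fset <-> triangle v x y.
Proof.
move=> vx vy xy; rewrite /= /link_faces /= fsetUA !inE negb_or vx vy.
split=> [[]//|[_ _ _ ?]]; split=> //.
by apply/fset0Pn; exists x; rewrite !inE eqxx.
Qed.

Lemma G5_pairP p q : p != q -> faces G5 [fset p; q]%fset <-> G5_edge p q.
Proof.
move=> pq; split=> [[[x]|[x [y [xy]]]]|e]; last by right; exists p, q.
- move=> E; have := fset21 p q; have := fset22 p q; rewrite E !inE.
  by move=> /eqP qx /eqP px; rewrite px qx eqxx in pq.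
- move=> E; have := fset21 p q; have := fset22 p q; rewrite E !inE.
  case/orP=> /eqP qE /orP[] /eqP pE; move: pq; rewrite pE qE ?eqxx // => _.
  by move: xy; rewrite /G5_edge /= orbC.
Qed.

(** The labelling is the inverse of the given isomorphism, which is tested on pairs of vertices
    only. *)
Lemma link_paramP (v : V) :
  simplicially_isomorphic (link X v) G5 -> exists g, link_param v g.
Proof.
case=> f [[h fK hK] fP].
have G5v p : p \in vertices G5 by rewrite inE; left; exists p.
pose c p : vertices G5 := exist _ p (G5v p).
exists (fun p => val (h (c p))).
have linkv (a : vertices (link X v)) : v != val a.
  by have := set_valP a => /link_vertexP [].
have g_inj : injective (fun p => val (h (c p))).
  by move=> p q /val_inj /(can_inj hK) /(congr1 val).
split=> // [p q|x y T].
- have := fP [fset h (c p); h (c q)]%fset.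
  rewrite !imfset_pair !hK => gP.
  split=> [T|e].
    have pq : p != q.
      by have [_ _ + _] := T; apply: contraNneq => ->.
    by apply/(G5_pairP pq)/gP/link_pairP; case: (T).
  have pq := G5_edge_neq e.
  apply/link_pairP; rewrite ?linkv ?(inj_eq g_inj) //.
  by apply/gP/G5_pairP.
- have Lx : x \in vertices (link X v).
    rewrite inE; apply/link_vertexP; case: T => vx _ _ Xvxy; split=> //.
    apply: (face_sub Xvxy); last exact: fsubsetUl.
    by apply/fset0Pn; exists x; rewrite !inE eqxx orbT.
  exists (val (f (exist _ x Lx))).
  have -> : c (val (f (exist _ x Lx))) = f (exist _ x Lx) by apply: val_inj.
  by rewrite fK.
Qed.

(** The triangles on the edge from [v] to [g p] correspond to the neighbours of [p]: two for a
    [Mid], at least three otherwise. *)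
Lemma link_param_degree v g p : link_param v g -> degree_le2 v (g p) <-> is_mid p.
Proof.
move=> [g_inj gE g_surj]; split; last first.
  case: p => // i _; exists (g (Hex i)), (g (if odd i then Top else Bot)) => z T.
  have [q zq] := g_surj _ _ (triangle_swap23 T).
  by move: T; rewrite zq => /gE /Mid_edge [->|->]; [left | right].
case=> a [b ab]; apply: contraT => /edges_of_not_mid [q1 [q2 [i [e1 e2 e3]]]].
rewrite -(map_inj_uniq g_inj) => U.
(* Pigeonhole: three distinct points do not fit among [a] and [b]. *)
have /(uniq_leq_size U) // : {subset map g [:: q1; q2; Mid i] <= [:: a; b]}.
move=> z /mapP[q qin ->]; rewrite !inE; apply/orP.
have /gE /ab : G5_edge p q by move: qin; rewrite !inE => /or3P[] /eqP ->.
by case=> ->; rewrite eqxx; [left | right].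
Qed.

End Triangles.

Theorem proposition0p7 :
  ~ exists (V : choiceType) (X : simplicial_complex V),
      vertices X !=set0 /\
      forall v : V, vertices X v -> simplicially_isomorphic (link X v) G5.
Proof.
case=> V [X [[v Xv] linkX]].
have par u : vertices X u -> exists g, link_param X u g.
  by move=> /linkX /link_paramP.
have [g gP] := par _ Xv; have [_ gE g_surj] := gP.
(* Any neighbour of [Top] would do here: the triangle only serves to place [v] in the link of
   [g Top]. *)
have Tvx : triangle X v (g Top) (g (Mid (@Ordinal 6 1 isT))).
  by apply/gE; rewrite /G5_edge.
move: (triangle_swap12 Tvx) => Txv.
have [g' g'P] := par _ (triangle_vertex Txv); have [_ g'E g'_surj] := g'P.
have [p vp] := g'_surj _ _ Txv.
have pN : ~~ is_mid p.
  (* The degree of an edge is the same seen from either end, and [Top] is not a [Mid]. *)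
  apply/negP => /(link_param_degree _ g'P); rewrite -vp => /degree_le2C.
  by move=> /(link_param_degree _ gP).
have [_ [_ [i [_ _ /g'E Txvy _]]]] := edges_of_not_mid pN.
move: (Txvy); rewrite -vp => {}Txvy; set y := g' (Mid i) in Txvy.
have xy2 : degree_le2 X (g Top) y by apply/(link_param_degree _ g'P).
have Tvxy := triangle_swap12 Txvy.
have [q yq] := g_surj _ _ (triangle_swap23 Tvxy).
have vy2 : degree_le2 X v y.
  rewrite yq; apply/(link_param_degree _ gP)/Top_edge_mid/gE.
  by rewrite -yq.
have Tyvx := triangle_swap12 (triangle_swap23 Tvxy).
(* In the link of [y], the adjacent vertices [v] and [g Top] would now both be labelled by a
   [Mid]. *)
have [k kP] := par _ (triangle_vertex Tyvx); have [_ kE k_surj] := kP.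
have [r vr] := k_surj _ _ Tyvx; have [s xs] := k_surj _ _ (triangle_swap23 Tyvx).
have : is_mid r by apply/(link_param_degree _ kP)/degree_le2C; rewrite -vr.
have : is_mid s by apply/(link_param_degree _ kP)/degree_le2C; rewrite -xs.
move: Tyvx; rewrite vr xs => /kE; case: r {vr} => // j /Mid_edge_not_mid.
by move=> /negPf ->.
Qed.
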